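(* A combinatorial proposition $P$ is true if and only if it has a combinatorial proof, i.e. there exist a nicely coloured cograph $C$ and a skew fibration $h:C\to P$ all of whose colour classes are axiomatic.
   Context: A graph $(V,E)$: finite $V$, $E$ a set of two-element subsets (edges) of $V$; write $vw$ for $\{v,w\}$. A homomorphism $h:G\to G'$ maps vertices so that $vw\in E(G)\Rightarrow h(v)h(w)\in E(G')$. A cograph is a graph with nonempty vertex set such that for distinct $v,w,x,y$ the edges among $\{v,w,x,y\}$ are never exactly $\{vw,wx,xy\}$. Atoms: literals $p,\overline p$ (for variables $p$) and constants $0,1$; $p,\overline p$ are dual, as are $0,1$. An $\mathcal{A}$-labelled graph assigns an atom to each vertex. A combinatorial proposition is an $\mathcal{A}$-labelled cograph. A set of vertices is stable if it contains no edge; a clause is a maximal stable set; a clause is true if it contains a $1$-labelled vertex or two vertices labelled by dual literals; a labelled graph is true if all its clauses are true. A coloured graph has an equivalence relation $\sim$ on $V$ with $v\sim w$, $v\ne w$ implying $vw\notin E$; classes are colour classes. $W\subseteq V$ induces a matching if $W\ne\emptyset$ and each $w\in W$ has a unique $w'\in W$ with $ww'\in E$. The colouring is nice if every colour class has at most two vertices and no union of two-vertex colour classes induces a matching. A homomorphism $h:G\to G'$ is a skew fibration if for all $v\in V(G)$ and $w$ with $h(v)w\in E(G')$ there is $\hat w$ with $v\hat w\in E(G)$ and $h(\hat w)w\notin E(G')$. For $h:C\to P$ with $P$ $\mathcal{A}$-labelled, a colour class $\{v\}$ is axiomatic if $h(v)$ is labelled $1$; a class $\{v,w\}$ is axiomatic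 if $h(v),h(w)$ are labelled by dual literals. *)

(* Defs.v *)
From HB Require Import structures.
From mathcomp Require Import all_boot.

Set Implicit Arguments.
Unset Strict Implicit.
Unset Printing Implicit Defensive.

(* The edge set is represented by its (symmetric, irreflexive) adjacency
   relation: [edge v w] stands for {v, w} being an edge. *)
Record graph := Graph {
  vertex :> finType;
  edge : rel vertex;
  edge_sym : symmetric edge;
  edge_irr : irreflexive edge }.

Definition homomorphism (G G' : graph) (h : G -> G') : Prop :=
  forall v w : G, edge v w -> edge (h v) (h w).

Definition skew_fibration (G G' : graph) (h : G -> G') : Prop :=
  homomorphism h /\
  forall (v : G) (w : G'), edge (h v) w ->
    exists w' : G, edge v w' /\ ~~ edge (h w') w.

Definition cograph (G : graph) : Prop :=
  0 < #|G| /\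
  forall v w x y : G, uniq [:: v; w; x; y] ->
    ~~ [&& edge v w, edge w x, edge x y,
           ~~ edge v x, ~~ edge w y & ~~ edge v y].

Section Atoms.

Variable X : eqType.

Inductive atom := Pos of X | Neg of X | Zero | One.

Definition atom_code (a : atom) : bool * X + bool :=
  match a with
  | Pos p => inl (true, p)
  | Neg p => inl (false, p)
  | Zero => inr false
  | One => inr true
  end.

Definition atom_decode (c : bool * X + bool) : atom :=
  match c with
  | inl (true, p) => Pos p
  | inl (false, p) => Neg p
  | inr false => Zero
  | inr true => One
  end.

Lemma atom_codeK : cancel atom_code atom_decode.
Proof. by case. Qed.

HB.instance Definition _ := Equality.copy atom (can_type atom_codeK).

Definition literal (a : atom) : bool :=
  match a with Pos _ | Neg _ => true | Zero | One => false end.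

Definition dual (a : atom) : atom :=
  match a with
  | Pos p => Neg p
  | Neg p => Pos p
  | Zero => One
  | One => Zero
  end.

(* The constants are dual to each other but are not literals. *)
Definition dual_literals (a b : atom) : bool := literal a && (b == dual a).

Record labelled_graph := LabelledGraph {
  lgraph :> graph;
  label : lgraph -> atom }.

End Atoms.

Arguments Zero {X}.
Arguments One {X}.

Definition stable (G : graph) (W : {set G}) : bool :=
  [forall v in W, forall w in W, ~~ edge v w].

Definition clause (G : graph) (W : {set G}) : bool := maxset (@stable G) W.

Definition true_clause (X : eqType) (P : labelled_graph X) (W : {set P}) : Prop :=
  (exists2 v, v \in W & label v = One) \/
  (exists v w, [/\ v \in W, w \in W & dual_literals (label v) (label w)]).

Definition true_graph (X : eqType) (P : labelled_graph X) : Prop :=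
  forall W : {set P}, clause W -> true_clause W.

Record coloured_graph := ColouredGraph {
  cgraph :> graph;
  colour : rel cgraph;
  colour_equiv : equivalence_rel colour;
  colour_stable : forall v w : cgraph, colour v w -> v != w -> ~~ edge v w }.

Definition colour_classes (C : coloured_graph) : {set {set C}} :=
  equivalence_partition (@colour C) [set: C].

Definition induces_matching (G : graph) (W : {set G}) : Prop :=
  W != set0 /\
  forall w, w \in W -> exists! w', w' \in W /\ edge w w'.

Definition nice (C : coloured_graph) : Prop :=
  (forall K, K \in colour_classes C -> #|K| <= 2) /\
  (forall S : {set {set C}}, S \subset colour_classes C ->
     (forall K, K \in S -> #|K| = 2) -> ~ induces_matching (cover S)).

Definition axiomatic (X : eqType) (C : graph) (P : labelled_graph X)
    (h : C -> P) (K : {set C}) : Prop :=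
  (exists2 v, K = [set v] & label (h v) = One) \/
  (exists v w, [/\ v != w, K = [set v; w] &
                   dual_literals (label (h v)) (label (h w))]).

Definition combinatorial_proof (X : eqType) (P : labelled_graph X)
    (C : coloured_graph) (h : C -> P) : Prop :=
  [/\ cograph C, nice C, skew_fibration h &
      forall K, K \in colour_classes C -> axiomatic h K].

(* Main.v *)
(* Soundness: a skew fibration pulls clauses back to clauses, and every clause of
   a nicely coloured cograph contains a colour class; otherwise, following
   alternately a two-vertex class out of the clause and an edge back into it, a
   shortest cycle would induce a matching.

   Completeness: if P has an edge, then P = Q \/ (R /\ S) with no edge between Q
   and R u S and all edges between R and S.  The truth of P yields that of Q \/ R
   and Q \/ S, and the inductively given proofs of these are fused by adding all
   edges between the vertices over R in the first and the vertices over S in the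
   second. *)
Require Import Defs.
From mathcomp Require Import all_boot.

Set Implicit Arguments.
Unset Strict Implicit.
Unset Printing Implicit Defensive.

(** * Perfect matchings and chordless cycles *)

Definition uniquely_matched (T : finType) (e : rel T) (W : {set T}) : Prop :=
  forall w, w \in W -> exists! w', w' \in W /\ e w w'.

(** Deleting a vertex together with its unique partner leaves a uniquely matched set, so induction
    removes elements two at a time. *)
Lemma uniquely_matched_even (T : finType) (e : rel T) (W : {set T}) :
  symmetric e -> irreflexive e -> uniquely_matched e W -> ~~ odd #|W|.
Proof.
move=> eC eI; have [n] := ubnP #|W|; elim: n W => // n IHn W ltWn mW.
have [->|[w wW]] := set_0Vmem W; first by rewrite cards0.
have [u [[uW ewu] uU]] := mW w wW.
have neq_uw : u != w by apply/eqP=> eq_uw; rewrite eq_uw eI in ewu.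
have uWw : u \in W :\ w by rewrite !inE neq_uw.
rewrite (cardsD1 w) wW (cardsD1 u) uWw /= negbK; apply: IHn.
  move: ltWn; rewrite (cardsD1 w W) wW (cardsD1 u (W :\ w)) uWw.
  by rewrite !add1n ltnS => /ltnW.
move=> x; rewrite !inE => /and3P[neq_xu neq_xw xW].
have [y [[yW exy] yU]] := mW x xW.
exists y; split; last by move=> z [+ exz]; rewrite !inE => /and3P[_ _ zW]; apply: yU.
split=> //; rewrite !inE yW andbT; apply/andP; split; apply/eqP=> eq_y.
  have [z [_ zU]] := mW u uW.
  have zw : z = w by apply: zU; rewrite eC.
  have zx : z = x by apply: zU; rewrite eC -eq_y.
  by rewrite -zx zw eqxx in neq_xw.
by rewrite -(uU x) ?eqxx // in neq_xu; rewrite eC -eq_y.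
Qed.

(* A minimal nonempty subset in which every vertex keeps a successor is the
   vertex set of a chordless cycle. *)
Lemma chordless_cycle (T : finType) (r : rel T) (A : {set T}) :
  A != set0 -> (forall x, x \in A -> exists2 y, y \in A & r x y) ->
  exists Z : {set T}, [/\ Z \subset A, Z != set0, uniquely_matched r Z
    & uniquely_matched (fun x y => r y x) Z].
Proof.
move=> A0 sA.
pose ok (Z : {set T}) := (Z != set0) && [forall x in Z, exists y in Z, r x y].
have okA : ok A.
  rewrite /ok A0; apply/forall_inP=> x /sA[y yA rxy].
  by apply/exists_inP; exists y.
have [Z /minsetP[/andP[Z0 sZ] minZ] subZA] := minset_exists okA.
have {}sZ x : x \in Z -> exists2 y, y \in Z & r x y.
  by move=> xZ; apply/exists_inP; move/forall_inP: sZ => ->.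
(* The image of a successor choice on [Z] again has the property for which [Z] is minimal, so every
   such choice permutes [Z]. *)
have imZ (f : T -> T) :
    (forall x, x \in Z -> (f x \in Z) && r x (f x)) -> f @: Z = Z.
  move=> fP; apply: minZ.
    apply/andP; split.
      by have [x xZ] := set0Pn _ Z0; apply/set0Pn; exists (f x); apply: imset_f.
    apply/forall_inP=> _ /imsetP[x xZ ->]; apply/exists_inP.
    have /andP[fxZ _] := fP x xZ; have /andP[ffxZ rf] := fP _ fxZ.
    by exists (f (f x)) => //; apply: imset_f.
  by apply/subsetP=> _ /imsetP[x xZ ->]; have /andP[] := fP x xZ.
pose s x := odflt x [pick y | (y \in Z) && r x y].
have sP x : x \in Z -> (s x \in Z) && r x (s x).
  rewrite /s; case: pickP => [y // |noy /sZ[y yZ rxy]].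
  by have := noy y; rewrite yZ rxy.
have injZ x1 x2 y :
    x1 \in Z -> x2 \in Z -> y \in Z -> r x1 y -> r x2 y -> x1 = x2.
  move=> x1Z x2Z yZ r1 r2.
  (* Sending both [x1] and [x2] to [y] is a successor choice too; as it permutes [Z], the two
     coincide. *)
  pose f x := if (x == x1) || (x == x2) then y else s x.
  have fP x : x \in Z -> (f x \in Z) && r x (f x).
    by rewrite /f; case: ifP => [/orP[] /eqP-> _|_ /sP //]; rewrite yZ ?r1 ?r2.
  have /imset_injP fI : #|f @: Z| == #|Z| by rewrite imZ.
  by apply: fI; rewrite // /f !eqxx orbT.
exists Z; split=> // [x xZ | y yZ].
  have /andP[sxZ rsx] := sP x xZ.
  exists (s x); split=> // b [bZ rxb].
  have /imsetP[y yZ def_b] : b \in s @: Z by rewrite imZ.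
  have /andP[_ ryb] := sP y yZ; rewrite -def_b in ryb.
  by rewrite def_b (injZ x y b).
have /imsetP[x xZ def_y] : y \in s @: Z by rewrite imZ.
have /andP[_ rxy] := sP x xZ; rewrite -def_y in rxy.
by exists x; split=> // x' [x'Z rx'y]; apply: (injZ x x' y).
Qed.

(** * Cographs and clauses *)

(** The forbidden path in its working form; distinctness of the four vertices follows from the edges
    and non-edges themselves. *)
Lemma cograph_P4 (G : graph) (v w x y : G) : cograph G ->
  edge v w -> edge w x -> edge x y -> ~~ edge v x -> ~~ edge w y -> edge v y.
Proof.
move=> [_ noP4] vw wx xy vx wy; apply: contraT => vy.
have neq (a b : G) : edge a b -> a != b.
  by move=> eab; apply/eqP=> eq_ab; rewrite eq_ab edge_irr in eab.
have /noP4 : uniq [:: v; w; x; y].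
  rewrite /= !inE !negb_or (neq _ _ vw) (neq _ _ wx) (neq _ _ xy) /= !andbT -andbA.
  apply/and3P; split.
  - by apply/eqP=> eq_vx; rewrite eq_vx xy in vy.
  - by apply: contraNneq wy => <-; rewrite edge_sym.
  by apply/eqP=> eq_wy; rewrite -eq_wy vw in vy.
by rewrite vw wx xy vx wy vy.
Qed.

Lemma clause_neighbour (G : graph) (M : {set G}) (v : G) :
  clause M -> v \notin M -> exists2 w, w \in M & edge v w.
Proof.
move=> /maxsetP[/forall_inP stM maxM] vM; apply/exists_inP.
apply: contraNT vM => /exists_inPn noe.
rewrite -(maxM (v |: M)) ?setU11 ?subsetUr //.
apply/forall_inP=> a /setU1P aM; apply/forall_inP=> b /setU1P bM.
case: aM bM => [->|aM] [->|bM]; rewrite ?edge_irr ?noe //.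
  by rewrite edge_sym noe.
by have /forall_inP-> := stM a aM.
Qed.

Lemma clauseI (G : graph) (M : {set G}) : stable M ->
  (forall v, v \notin M -> exists2 w, w \in M & edge v w) -> clause M.
Proof.
move=> stM domM; apply/maxsetP; split=> // B /forall_inP stB sMB.
apply/eqP; rewrite eqEsubset sMB andbT; apply/subsetP=> v vB.
apply: contraT => /domM[w wM evw]; have /forall_inP := stB v vB.
by move/(_ w (subsetP sMB w wM)); rewrite evw.
Qed.

Lemma stableP (G : graph) (M : {set G}) (v w : G) :
  stable M -> v \in M -> w \in M -> edge v w = false.
Proof.
by move=> /forall_inP stM vM wM; apply: negbTE; have /forall_inP-> := stM v vM.
Qed.

(** * Pulling clauses back along skew fibrations *)

(** Suppose some vertex outside the preimage [M] has no neighbour in [M], and let [v] be one with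
    [NK v] minimal. Skew lifting yields neighbours [u] of [v] with smaller [NK u], which therefore
    do have neighbours in [M]. For such a [u] with [NM u] minimal and [k] in [NM u], lifting the
    edge from [h v] to [h k] yields one with still fewer neighbours in [M]. *)
Lemma skew_fibration_clause (G G' : graph) (h : G -> G') (K : {set G'}) :
  cograph G -> cograph G' -> skew_fibration h -> clause K ->
  clause (h @^-1: K).
Proof.
move=> coG coG' [homh skh] clK; have [stK _] := maxsetP clK.
set M := h @^-1: K.
have stM : stable M.
  apply/forall_inP=> a; rewrite inE => aK; apply/forall_inP=> b; rewrite inE => bK.
  by apply/negP=> /homh; rewrite (stableP stK).
apply: clauseI => //.
pose NK v := [set w in K | edge (h v) w]; pose NM u := [set k in M | edge u k].
pose bad v := (v \notin M) && (NM v == set0).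
suff noBad v : ~~ bad v.
  move=> v vM; have := noBad v; rewrite /bad vM => /set0Pn[w].
  by rewrite inE => /andP[wM evw]; exists w.
apply/negP=> badv.
case: (arg_minnP (P := bad) (fun v => #|NK v|) badv) => {badv}v badv minv.
have /andP[vM /eqP NMv] := badv.
have nbad u : edge v u -> u \notin M.
  by move=> evu; apply/negP=> uM; have := in_set0 u; rewrite -NMv inE uM evu.
have NKsub u w : edge v u -> w \in K -> edge (h v) w -> ~~ edge (h u) w ->
    NK u \proper NK v.
  move=> evu wK vw uw; apply/properP; split; last first.
    by exists w; rewrite inE wK ?vw.
  (* Otherwise [w], [h v], [h u], [w'] would be an induced path, as [K] is stable. *)
  apply/subsetP=> w'; rewrite !inE => /andP[w'K uw']; rewrite w'K /=.
  apply: contraT => vw'.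
  have := @cograph_P4 _ w (h v) (h u) w' coG'.
  by rewrite edge_sym vw homh // uw' edge_sym uw vw' (stableP stK) // => ->.
have good u : edge v u -> NK u \proper NK v -> NM u != set0.
  move=> evu /proper_card lt_uv; apply: contraL lt_uv => NMu.
  by rewrite -leqNgt minv // /bad nbad.
pose A u := edge v u && (NK u \proper NK v).
have [u0 Au0] : exists u, A u.
  have [w wK vw] : exists2 w, w \in K & edge (h v) w.
    by apply: clause_neighbour => //; move: vM; rewrite inE.
  have [u [evu uw]] := skh v w vw.
  by exists u; rewrite /A evu (NKsub u w).
case: (arg_minnP (P := A) (fun u => #|NM u|) Au0) => {u0 Au0}u /andP[evu NKu] minu.
have /set0Pn[k] := good u evu NKu; rewrite inE => /andP[kM uk].
have kK : h k \in K by move: kM; rewrite inE.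
have : h k \in NK v by apply: (subsetP (proper_sub NKu)); rewrite inE kK homh.
rewrite inE kK /= => vk; have [u' [evu' u'k]] := skh v (h k) vk.
have := minu u'; rewrite /A evu' (NKsub u' (h k)) // => /(_ isT).
apply/negP; rewrite -ltnNge; apply/proper_card/properP; split; last first.
  by exists k; rewrite inE kM ?uk //; apply: contra u'k => /homh.
have nvk : ~~ edge v k by apply: contraL kM => /nbad.
have nu'k : ~~ edge u' k by apply: contra u'k => /homh.
(* Otherwise [u'], [v], [u], [k] would be an induced path. *)
have uu' : edge u' u.
  apply: contraT => nuu'; have := @cograph_P4 _ u' v u k coG.
  by rewrite edge_sym evu' evu uk nuu' nvk (negbTE nu'k) => ->.
(* A [k'] in [NM u'] but not in [NM u] would give the induced path [k], [u], [u'], [k'], as [M] is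
   stable. *)
apply/subsetP=> k'; rewrite !inE => /andP[k'K u'k']; rewrite k'K /=.
apply: contraT => nuk'; have := @cograph_P4 _ k u u' k' coG.
rewrite edge_sym uk edge_sym uu' u'k' edge_sym nu'k nuk' (stableP stM) //.
  by move=> ->.
by rewrite inE.
Qed.

(** * Nice colourings *)

Lemma colour_refl (C : coloured_graph) (x : C) : colour x x.
Proof. by have [] := colour_equiv (c := C) x x x. Qed.

Lemma colour_left (C : coloured_graph) (x y z : C) :
  colour x y -> colour x z = colour y z.
Proof. by have [_] := colour_equiv (c := C) x y z. Qed.

Lemma colour_sym (C : coloured_graph) : symmetric (@colour C).
Proof.
have sub x y : @colour C x y -> colour y x.
  by move=> xy; rewrite -(colour_left _ xy) colour_refl.
by move=> x y; apply/idP/idP; apply: sub.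
Qed.

Lemma colour_classesP (C : coloured_graph) (K : {set C}) :
  reflect (exists x, K = [set y | colour x y]) (K \in colour_classes C).
Proof.
apply: (iffP imsetP) => [[x _ ->]|[x ->]]; exists x => //;
  by apply/setP=> y; rewrite !inE.
Qed.

Definition distinct_colour (C : coloured_graph) : rel C :=
  fun x y => colour x y && (x != y).

Lemma distinct_colour_sym (C : coloured_graph) : symmetric (@distinct_colour C).
Proof. by move=> x y; rewrite /distinct_colour colour_sym eq_sym. Qed.

Lemma distinct_colour_irr (C : coloured_graph) :
  irreflexive (@distinct_colour C).
Proof. by move=> x; rewrite /distinct_colour eqxx andbF. Qed.

(* The unions of two-vertex colour classes are the sets W below. *)
Lemma niceP (C : coloured_graph) :
  nice C <->
  (forall x y z : C, distinct_colour x y -> distinct_colour x z -> y = z) /\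
  (forall W : {set C},
     (forall v, v \in W -> exists2 u, u \in W & distinct_colour v u) ->
     ~ induces_matching W).
Proof.
split=> [[le2 noM]|[le2 noM]].
  have uni (x y z : C) : distinct_colour x y -> distinct_colour x z -> y = z.
    move=> /andP[xy nxy] /andP[xz nxz]; apply/eqP; apply: contraT => nyz.
    have /le2 : [set t | colour x t] \in colour_classes C.
      by apply/colour_classesP; exists x.
    have /subset_leq_card : [set x; y; z] \subset [set t | colour x t].
      by apply/subsetP=> t; rewrite !inE => /orP[/orP[]|] /eqP->;
        rewrite ?colour_refl.
    rewrite -setUA cardsU1 !inE negb_or nxy nxz cards2 nyz => le3 /(leq_trans le3).
    by [].
  split=> // W satW; pose S := [set [set y | colour x y] | x in W].
  have coverS : cover S = W.
    apply/setP=> y; apply/bigcupP/idP=> [[_ /imsetP[x xW ->]]|yW].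
      rewrite inE => xy; have [<- //|nxy] := eqVneq x y.
      have [u uW xu] := satW x xW; rewrite (uni x y u) //.
      by rewrite /distinct_colour xy.
    by exists [set z | colour y z]; rewrite ?inE ?colour_refl //; apply: imset_f.
  rewrite -coverS; apply: noM.
    by apply/subsetP=> _ /imsetP[x _ ->]; apply/colour_classesP; exists x.
  move=> _ /imsetP[x xW ->]; have [u uW xu] := satW x xW.
  have /andP[cxu nxu] := xu.
  suff -> : [set y | colour x y] = [set x; u] by rewrite cards2 nxu.
  apply/setP=> y; rewrite !inE; apply/idP/orP=> [cxy|[/eqP->|/eqP->] //].
    have [|nyx] := eqVneq y x; first by left.
    by right; rewrite (uni x y u) // /distinct_colour cxy eq_sym.
  exact: colour_refl.
split=> [_ /colour_classesP[x ->]|S sS S2].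
  have [[y xy]|none] := altP (existsP (P := distinct_colour x)); last first.
    rewrite (leq_trans _ (leqnSn 1)) // -(cards1 x) subset_leq_card //.
    apply/subsetP=> y; rewrite !inE => cxy; apply: contraNT none => nyx.
    by apply/existsP; exists y; rewrite /distinct_colour cxy eq_sym.
  apply: (@leq_trans #|[set x; y]|); last by rewrite cards2; case: (x != y).
  apply: subset_leq_card; apply/subsetP=> z; rewrite !inE => cxz.
  have [//|nzx] := eqVneq z x.
  by rewrite (le2 x z y) ?eqxx // /distinct_colour cxz eq_sym.
apply: noM => v /bigcupP[K KS vK].
have /colour_classesP[x defK] := subsetP sS K KS.
have : K :\ v != set0 by rewrite -card_gt0 cardsDS ?sub1set // cards1 S2.
move=> /set0Pn[u]; rewrite !inE => /andP[nuv uK].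
exists u; first by apply/bigcupP; exists K.
rewrite /distinct_colour eq_sym nuv andbT.
move: vK uK; rewrite defK !inE => xv; by rewrite (colour_left _ xv).
Qed.

Lemma nice_clause (C : coloured_graph) (M : {set C}) :
  cograph C -> nice C -> clause M ->
  exists2 K, K \in colour_classes C & K \subset M.
Proof.
move=> coC /niceP[uni noM] clM; have [stM _] := maxsetP clM.
apply/exists_inP; apply: contraT => /exists_inPn noK.
have esc x : exists2 y, colour x y & y \notin M.
  have /noK/subsetPn[y] : [set y | colour x y] \in colour_classes C.
    by apply/colour_classesP; exists x.
  by rewrite inE; exists y.
pose p x := odflt x [pick y | colour x y && (y \notin M)].
have /all_and2[cp pM] x : colour x (p x) /\ p x \notin M.
  rewrite /p; case: pickP => [y /andP[] //|noy].
  by have [y xy yM] := esc x; have := noy y; rewrite xy yM.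
have dp x : x \in M -> distinct_colour x (p x).
  by move=> xM; rewrite /distinct_colour cp; apply: contraTneq xM => ->.
have M0 : M != set0.
  have [/card_gt0P[x _] _] := coC.
  have [w wM _] := clause_neighbour clM (pM x).
  by apply/set0Pn; exists w.
(* Arcs lead from [x] to the neighbours of [p x] in [M]; along the cycle [Z], each [p x] is matched
   with the successor of [x]. *)
have := @chordless_cycle _ (fun x y => edge (p x) y) M M0.
case=> [x xM|Z [/subsetP sZM Z0 outZ inZ]].
  exact: clause_neighbour clM (pM x).
have inU x y z : x \in Z -> y \in Z -> z \in Z -> edge (p x) z -> edge (p y) z -> x = y.
  by move=> xZ yZ zZ xz yz; have [t [_ tU]] := inZ z zZ; rewrite -(tU x) // (tU y).
(* With [a] and [b] the successors of [x] and [y], an edge between [p x] and [p y] would give the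
   induced path [a], [p x], [p y], [b]: neither [a] nor [b] has a second predecessor in [Z], and [M]
   is stable. *)
have noE x y : x \in Z -> y \in Z -> ~~ edge (p x) (p y).
  move=> xZ yZ; apply/negP=> pxy.
  have [a [[aZ xa] _]] := outZ x xZ; have [b [[bZ yb] _]] := outZ y yZ.
  have nxy : x != y by apply/eqP=> eq_xy; rewrite eq_xy edge_irr in pxy.
  have := @cograph_P4 _ a (p x) (p y) b coC.
  rewrite edge_sym xa pxy yb (stableP (v := a) (w := b) stM) ?sZM // => H.
  suff : false by []; apply: H => //; apply: contra nxy => e; apply/eqP.
    by apply: (inU x y a) => //; rewrite edge_sym.
  exact: (inU x y b).
exfalso; apply: (noM (Z :|: p @: Z)).
  move=> v /setUP[vZ|/imsetP[x xZ ->]].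
    by exists (p v); rewrite ?dp ?sZM // inE imset_f ?orbT.
  by exists x; rewrite ?inE ?xZ // distinct_colour_sym dp ?sZM.
split.
  by have /set0Pn[x xZ] := Z0; apply/set0Pn; exists x; rewrite inE xZ.
move=> w /setUP[wZ|/imsetP[x xZ ->]].
  have [y [[yZ yw] yU]] := inZ w wZ; exists (p y); split.
    by rewrite inE imset_f ?orbT // edge_sym.
  move=> u [/setUP[uZ|/imsetP[t tZ ->]]]; first by rewrite (stableP stM) ?sZM.
  by rewrite edge_sym => tw; rewrite (yU t).
have [z [[zZ xz] zU]] := outZ x xZ; exists z; split; first by rewrite inE zZ.
move=> u [/setUP[uZ|/imsetP[t tZ ->]] xu]; first exact: zU.
by rewrite (negbTE (noE _ _ _ _)) in xu.
Qed.

(** * Soundness of combinatorial proofs *)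

Lemma soundness (X : eqType) (P : labelled_graph X) (C : coloured_graph)
    (h : C -> P) :
  cograph P -> combinatorial_proof h -> true_graph P.
Proof.
move=> coP [coC nC skh axC] W clW.
have [K KC /subsetP sK] :=
  nice_clause coC nC (skew_fibration_clause coC coP skh clW).
have {}sK v : v \in K -> h v \in W by move/sK; rewrite inE.
case: (axC K KC) => [[v eqK lv]|[v [w [_ eqK lvw]]]].
  by left; exists (h v); rewrite ?sK ?eqK ?inE.
by right; exists (h v), (h w); rewrite !sK ?eqK ?inE ?eqxx ?orbT.
Qed.

(** * Splitting a cograph at an edge *)

(* Take R and S to be completely joined with |R| + |S| maximal.  A vertex q
   adjacent to R, but neither to all of R nor to all of S, would allow the pair
   (R n N(q), (R \ N(q)) u S u {q}) instead. *)
Lemma cograph_split (G : graph) (A : {set G}) (x y : G) :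
  cograph G -> x \in A -> y \in A -> edge x y ->
  exists R S : {set G}, [/\ R \subset A /\ S \subset A, R != set0, S != set0,
    forall r s, r \in R -> s \in S -> edge r s
    & forall q r, q \in A :\: (R :|: S) -> r \in R :|: S -> ~~ edge q r].
Proof.
move=> coG xA yA exy.
pose ok (U : {set G} * {set G}) := [&& U.1 \subset A, U.2 \subset A, U.1 != set0,
  U.2 != set0 & [forall r in U.1, forall s in U.2, edge r s]].
have okI (R S : {set G}) : R \subset A -> S \subset A -> R != set0 -> S != set0 ->
    (forall r s, r \in R -> s \in S -> edge r s) -> ok (R, S).
  move=> RA SA R0 S0 RS; apply/and5P; split=> //.
  by apply/forall_inP=> r rR; apply/forall_inP=> s; apply: RS.
have ok0 : ok ([set x], [set y]).
  apply: okI; rewrite ?sub1set -?card_gt0 ?cards1 //.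
  by move=> r s /set1P-> /set1P->.
case: (arg_maxnP (P := ok) (fun U => #|U.1| + #|U.2|) ok0) => -[R S] /=.
case/and5P=> /= RA SA R0 S0 /forall_inP RS maxRS.
have {}RS r s : r \in R -> s \in S -> edge r s.
  by move=> rR; apply/forall_inP/RS.
exists R, S; split=> // q r.
rewrite in_setD in_setU negb_or => /andP[/andP[qR qS] qA].
(* The roles of [R] and [S] are symmetric; the claim is later applied to both orders of the pair. *)
have key (R' S' : {set G}) r' : R' \subset A -> S' \subset A -> S' != set0 ->
    (forall r s, r \in R' -> s \in S' -> edge r s) ->
    q \notin R' -> q \notin S' -> r' \in R' ->
    (forall U, ok U -> #|U.1| + #|U.2| <= #|R'| + #|S'|) -> ~~ edge q r'.
  move=> R'A S'A S'0 R'S' qR' qS' r'R' max'; apply/negP=> qr'.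
  have R'0 : R' != set0 by apply/set0Pn; exists r'.
  have sub1 (B : {set G}) : B \subset A -> q |: B \subset A by rewrite subUset sub1set qA.
  have nz (B : {set G}) : q |: B != set0 by apply/set0Pn; exists q; rewrite setU11.
  (* A [q] adjacent to all of [S'] could be added to [R'], against maximality. *)
  have [s s' qs] : exists2 s, s \in S' & ~~ edge q s.
    apply/exists_inP; apply: contraT => /exists_inPn allS.
    have /max' : ok (q |: R', S').
      apply: okI; rewrite ?sub1 // => a b /setU1P[->|]; last exact: R'S'.
      by move/allS; rewrite negbK.
    by rewrite /= cardsU1 qR' addnAC leqNgt addnC ltnS leqnn.
  have [t tR' qt] : exists2 t, t \in R' & ~~ edge q t.
    apply/exists_inP; apply: contraT => /exists_inPn allR.
    have /max' : ok (R', q |: S').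
      apply: okI; rewrite ?sub1 // => a b aR /setU1P[->|]; last exact: R'S'.
      by rewrite edge_sym; move/allR: aR; rewrite negbK.
    by rewrite /= cardsU1 qS' addnCA ltnn.
  pose R1 := [set r in R' | edge q r].
  have subR1 : R1 \subset R' by apply/subsetP=> a; rewrite inE => /andP[].
  have /max' : ok (R1, q |: ((R' :\: R1) :|: S')).
    apply: okI => //.
    - exact: subset_trans subR1 _.
    - by rewrite sub1 // subUset S'A (subset_trans (subsetDl _ _)).
    - by apply/set0Pn; exists r'; rewrite inE r'R'.
    move=> a b; rewrite !inE => /andP[aR' qa] /or3P[/eqP->||].
    - by rewrite edge_sym.
    - case/andP=> nb bR'; rewrite bR' /= in nb.
      (* Otherwise [q], [a], [s], [b] would be an induced path. *)
      apply: contraT => nab; have := @cograph_P4 _ q a s b coG.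
      by rewrite qa R'S' // edge_sym R'S' // nab qs (negbTE nb) => ->.
    exact: R'S'.
  (* The new pair gains exactly the vertex [q]: being completely joined, [R'] and [S'] are
     disjoint. *)
  rewrite /= cardsU1 !inE (negbTE qR') (negbTE qS') andbF cardsU.
  have -> : (R' :\: R1) :&: S' = set0.
    apply/setP=> a; rewrite !inE; apply/negbTE/negP=> /andP[/andP[_ aR'] aS'].
    by have := R'S' a a aR' aS'; rewrite edge_irr.
  rewrite cards0 subn0 cardsDS //= add1n addnS addnA subnKC ?subset_leq_card //.
  by rewrite ltnn.
case/setUP=> [rR|rS]; first by apply: (key R S).
apply: (key S R) => //; last by move=> U okU; rewrite [leqRHS]addnC; apply: maxRS.
by move=> a b aS bR; rewrite edge_sym RS.
Qed.

(** * Fusion of two coloured cographs *)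

Section Fusion.

Variables (C1 C2 : coloured_graph) (B1 : pred C1) (B2 : pred C2).

Definition fusion_edge : rel (C1 + C2) := fun u v =>
  match u, v with
  | inl x, inl y => edge x y
  | inr x, inr y => edge x y
  | inl x, inr y => B1 x && B2 y
  | inr y, inl x => B1 x && B2 y
  end.

Lemma fusion_edge_sym : symmetric fusion_edge.
Proof. by case=> x [y|y] //=; rewrite edge_sym. Qed.

Lemma fusion_edge_irr : irreflexive fusion_edge.
Proof. by case=> x /=; rewrite edge_irr. Qed.

Definition fusion_graph := Graph fusion_edge_sym fusion_edge_irr.

Definition fusion_colour : rel fusion_graph := fun u v =>
  match u, v with
  | inl x, inl y => colour x y
  | inr x, inr y => colour x y
  | _, _ => false
  end.

Lemma fusion_colour_equiv : equivalence_rel fusion_colour.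
Proof.
by case=> x [y|y] [z|z]; split; rewrite /= ?colour_refl // => /colour_left->.
Qed.

Lemma fusion_colour_stable (u v : fusion_graph) :
  fusion_colour u v -> u != v -> ~~ edge u v.
Proof. by case: u v => x [y|y] //= cxy nxy; apply: colour_stable. Qed.

Definition fusion := ColouredGraph fusion_colour_equiv fusion_colour_stable.

(** So [B1] and [B2] are unions of connected components, and the fusion is the join of these two
    parts beside the untouched remainders. *)
Hypothesis B1_edge : forall x y, edge x y -> B1 x = B1 y.
Hypothesis B2_edge : forall x y, edge x y -> B2 x = B2 y.

Lemma fusion_cograph : cograph C1 -> cograph C2 -> cograph fusion.
Proof.
move=> [C1_gt0 P4_1] [_ P4_2]; split.
  by rewrite card_sum; apply: leq_trans (leq_addr _ _).
move=> [v|v] [w|w] [x|x] [y|y] uvwxy; try exact: P4_1; try exact: P4_2.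
(* Paths meeting both sides: decide the edges, carrying membership in [B1] and [B2] along them, then
   decide the memberships. *)
all: rewrite /edge /=.
all: repeat match goal with
  | |- context [edge ?a ?b] => let e := fresh in case e: (edge a b) => //=;
      try (first [move: (B1_edge e) | move: (B2_edge e)])
  end.
all: repeat match goal with
  | |- context [B1 ?a] => case: (B1 a) => //=
  | |- context [B2 ?a] => case: (B2 a) => //=
  end.
Qed.

(* If W induced a matching and met both B1 and B2, it would do so in single
   vertices x and y matched with each other; then W1 minus x would be matched
   within C1, hence even, and so would be W1 as a union of two-vertex classes. *)
Lemma fusion_nice : nice C1 -> nice C2 -> nice fusion.
Proof.
move=> /niceP[uni1 noM1] /niceP[uni2 noM2]; apply/niceP; split.
  move=> [x|x] [y|y] [z|z] //= => [xy xz|xy xz]; congr (_ _).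
    exact: (uni1 x).
  exact: (uni2 x).
move=> W satW [W0 mW].
pose W1 := [set x : C1 | inl x \in W]; pose W2 := [set x : C2 | inr x \in W].
have sat1 v : v \in W1 -> exists2 u, u \in W1 & distinct_colour v u.
  by rewrite inE => /satW[[u|u] // uW vu]; exists u; rewrite ?inE.
have sat2 v : v \in W2 -> exists2 u, u \in W2 & distinct_colour v u.
  by rewrite inE => /satW[[u|u] // uW vu]; exists u; rewrite ?inE.
have eqm (w a b : fusion) :
    w \in W -> a \in W -> b \in W -> edge w a -> edge w b -> a = b.
  by move=> wW aW bW wa wb; have [t [_ tU]] := mW w wW; rewrite -(tU a) // (tU b).
have m1 (U : {set C1}) : U \subset W1 -> U != set0 ->
    (forall w u, w \in U -> u \in W -> edge (inl w : fusion) u ->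
       exists2 t, u = inl t & t \in U) ->
    induces_matching U.
  move=> /subsetP UW U0 stU; split=> // w wU.
  have := UW w wU; rewrite inE => wW; have [u [[uW wu] uU]] := mW _ wW.
  have [t eq_u tU] := stU w u wU uW wu; exists t; split.
    by split=> //; rewrite eq_u in wu.
  move=> t' [t'U wt']; have := UW t' t'U; rewrite inE => t'W.
  by have := uU (inl t') (conj t'W wt'); rewrite eq_u => -[].
have m2 (U : {set C2}) : U \subset W2 -> U != set0 ->
    (forall w u, w \in U -> u \in W -> edge (inr w : fusion) u ->
       exists2 t, u = inr t & t \in U) ->
    induces_matching U.
  move=> /subsetP UW U0 stU; split=> // w wU.
  have := UW w wU; rewrite inE => wW; have [u [[uW wu] uU]] := mW _ wW.
  have [t eq_u tU] := stU w u wU uW wu; exists t; split.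
    by split=> //; rewrite eq_u in wu.
  move=> t' [t'U wt']; have := UW t' t'U; rewrite inE => t'W.
  by have := uU (inr t') (conj t'W wt'); rewrite eq_u => -[].
have [/existsP[x /existsP[y /and4P[xW Bx yW By]]]|no12] :=
  boolP [exists x, exists y, [&& inl x \in W, B1 x, inr y \in W & B2 y]].
  (* Pairing off by colour makes [W1] even; pairing off by edges will make [W1 :\ x] even, a
     contradiction. *)
  have : ~~ odd #|W1|.
    apply: uniquely_matched_even (@distinct_colour_sym C1) (@distinct_colour_irr C1) _.
    move=> v vW; have [u uW vu] := sat1 v vW; exists u; split=> // t [_ vt].
    exact: uni1 vu vt.
  have xy : edge (inl x : fusion) (inr y : fusion) by rewrite /edge /= Bx By.
  rewrite (cardsD1 x) inE xW oddD /= negbK; apply/negP.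
  have [W1x0|W1x0] := eqVneq (W1 :\ x) set0; first by rewrite W1x0 cards0.
  apply: (uniquely_matched_even (@edge_sym C1) (@edge_irr C1)).
  have [] // := m1 (W1 :\ x); first exact: subsetDl.
  (* The partner of [w] lies in [C1], since [inr y] already has the partner [inl x]; and it is not
     [x], whose partner is [inr y]. *)
  move=> w [t|t]; rewrite !inE => /andP[nwx wW] tW wt; last first.
    have /= /andP[Bw _] := wt.
    have [eq_wx] := eqm (inr y) (inl w) (inl x) yW wW xW
      (introT andP (conj Bw By)) (introT andP (conj Bx By)).
    by rewrite eq_wx eqxx in nwx.
  exists t => //; rewrite !inE tW andbT; apply/eqP=> eq_tx.
  rewrite eq_tx edge_sym in wt.
  by have := eqm (inl x) (inl w) (inr y) xW wW yW wt xy.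
(* Without a cross edge inside [W], each nonempty side is matched within itself. *)
have no x y : inl x \in W -> inr y \in W -> B1 x && B2 y = false.
  move=> xW yW; apply: contraNF no12 => /andP[Bx By].
  by apply/existsP; exists x; apply/existsP; exists y; apply/and4P.
have [[x|x] xW] := set0Pn _ W0.
  apply: (noM1 W1) => //; apply: m1 => //.
    by apply/set0Pn; exists x; rewrite inE.
  move=> w [t|t]; rewrite inE => wW tW wt; first by exists t; rewrite ?inE.
  by move: wt; rewrite /edge /= no.
apply: (noM2 W2) => //; apply: m2 => //.
  by apply/set0Pn; exists x; rewrite inE.
move=> w [t|t]; rewrite inE => wW tW wt; last by exists t; rewrite ?inE.
by move: wt; rewrite /edge /= no.
Qed.

End Fusion.

(** * Completeness by induction on vertex sets *)

Section Completeness.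

Variables (X : eqType) (P : labelled_graph X).

(** The vertexwise form of [axiomatic], which passes through fusion without any handling of
    classes. *)
Definition axiomatic_at (C : coloured_graph) (h : C -> P) (x : C) : Prop :=
  (label (h x) = One /\ forall y, colour x y -> y = x) \/
  (exists2 y, distinct_colour x y & dual_literals (label (h x)) (label (h y))).

(* [h : C -> P] is a combinatorial proof of the subgraph of P induced by A. *)
Definition proof_over (A : {set P}) (C : coloured_graph) (h : C -> P) : Prop :=
  [/\ cograph C, nice C, homomorphism h,
      (forall v, h v \in A) /\
      (forall v w, w \in A -> edge (h v) w ->
         exists v', edge v v' /\ ~~ edge (h v') w)
    & forall x, axiomatic_at h x].

Definition provable (A : {set P}) : Prop :=
  exists (C : coloured_graph) (h : C -> P), proof_over A h.

(** Truth of the subgraph induced by [A]; its clauses appear as the stable dominating sets inside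
    [A], so that no subgraph has to be built. *)
Definition true_over (A : {set P}) : Prop :=
  forall W : {set P}, W \subset A -> stable W ->
    (forall x, x \in A -> x \notin W -> exists2 y, y \in W & edge x y) ->
    true_clause W.

Lemma proof_over_setT (C : coloured_graph) (h : C -> P) :
  proof_over [set: P] h -> combinatorial_proof h.
Proof.
move=> [coC nC homh [_ skh] axh]; split=> //.
  by split=> // v w; apply: skh; rewrite inE.
have [uni _] := iffLR (niceP C) nC.
move=> _ /colour_classesP[x ->]; case: (axh x) => [[lx x1]|[y xy dxy]].
  left; exists x => //; apply/setP=> y; rewrite !inE.
  by apply/idP/eqP=> [/x1|->] //; rewrite colour_refl.
have /andP[cxy nxy] := xy; right; exists x, y; split=> //.
apply/setP=> z; rewrite !inE; apply/idP/orP=> [cxz|[/eqP->|/eqP->] //].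
  have [|nzx] := eqVneq z x; first by left.
  by right; rewrite (uni x y z) // /distinct_colour cxz eq_sym.
exact: colour_refl.
Qed.

Lemma dual_literals_sym (a b : atom X) :
  dual_literals a b -> dual_literals b a.
Proof. by case: a => // p /eqP ->; rewrite /dual_literals /=. Qed.

Definition empty_edge (T : finType) : rel T := fun _ _ => false.

Lemma empty_edge_sym (T : finType) : symmetric (@empty_edge T).
Proof. by []. Qed.

Lemma empty_edge_irr (T : finType) : irreflexive (@empty_edge T).
Proof. by []. Qed.

(** The proof of an axiom: one vertex serves for the constant 1, two vertices for a pair of dual
    literals. *)
Definition axiom_link (T : finType) : coloured_graph :=
  @ColouredGraph (Graph (@empty_edge_sym T) (@empty_edge_irr T))
    (fun _ _ => true) (fun _ _ _ => conj isT (fun _ => erefl))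
    (fun _ _ _ _ => isT).

Lemma axiom_link_proof_over (T : finType) (A : {set P}) (h : axiom_link T -> P) :
  stable A -> 0 < #|T| <= 2 -> (forall v, h v \in A) ->
  (forall x, axiomatic_at h x) -> proof_over A h.
Proof.
move=> stA /andP[T_gt0 leT2] hA axh; split=> //.
  split=> [K _|S _ _ [/set0Pn[x xS] /(_ x xS)[y [[_]]]] //].
  exact: leq_trans (max_card _) leT2.
by split=> // v w wA; rewrite (stableP stA).
Qed.

Lemma provable_stable (A : {set P}) :
  stable A -> true_clause A -> provable A.
Proof.
move=> stA [[v vA lv]|[v [w [vA wA lvw]]]].
  exists (axiom_link unit), (fun _ => v); apply: axiom_link_proof_over => //.
    by rewrite card_unit.
  by move=> [] /=; left; split=> // -[].
exists (axiom_link bool), (fun b : bool => if b then v else w).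
apply: axiom_link_proof_over => //; first by rewrite card_bool.
  by case.
by case; right; [exists false | exists true] => //; apply: dual_literals_sym.
Qed.

(** A proof that avoids [R] lies over [Q], which has no edges to the rest of [A]; so no new edge has
    to be lifted. *)
Lemma proof_over_weaken (A Q R : {set P}) (C : coloured_graph) (h : C -> P) :
  Q \subset A -> (forall q r, q \in Q -> r \in A :\: Q -> ~~ edge q r) ->
  (forall v, h v \notin R) -> proof_over (Q :|: R) h -> proof_over A h.
Proof.
move=> /subsetP QA noQ noR [coC nC homh [hQR skh] axh].
have hQ v : h v \in Q by have := hQR v; rewrite inE (negbTE (noR v)) orbF.
split=> //; split=> [v|v w wA hvw]; first exact: QA.
apply: skh => //; rewrite inE; apply/orP; left; apply: contraT => wQ.
by have := noQ (h v) w (hQ v); rewrite hvw inE wQ wA => /(_ isT).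
Qed.

(** A clause [W] of [Q :|: R] contains [r] or a neighbour of [r], hence meets [R], as no neighbour
    of [r] lies in [Q]. So it dominates [S] and is a clause of [A]. *)
Lemma true_over_join (A Q R S : {set P}) :
  R != set0 -> A = Q :|: (R :|: S) ->
  (forall r s, r \in R -> s \in S -> edge r s) ->
  (forall q r, q \in Q -> r \in R :|: S -> ~~ edge q r) ->
  true_over A -> true_over (Q :|: R).
Proof.
move=> /set0Pn[r rR] defA RS noQ trA W sWQR stW maxW; apply: trA => //.
  by rewrite defA setUA (subset_trans sWQR) // subsetUl.
move=> x; rewrite defA setUA => /setUP[|xS] xW; first exact: maxW.
have [r' r'W r'R] : exists2 r', r' \in W & r' \in R.
  have [rW|rW] := boolP (r \in W); first by exists r.
  have [|y yW ery] := maxW r _ rW; first by rewrite inE rR orbT.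
  exists y => //; have /setUP[yQ|//] := subsetP sWQR y yW.
  by have := noQ y r yQ; rewrite inE rR edge_sym ery => /(_ isT).
by exists r' => //; rewrite edge_sym RS.
Qed.

Lemma provable_join (Q R S : {set P}) :
  (forall r s, r \in R -> s \in S -> edge r s) ->
  (forall q r, q \in Q -> r \in R :|: S -> ~~ edge q r) ->
  provable (Q :|: R) -> provable (Q :|: S) -> provable (Q :|: (R :|: S)).
Proof.
move=> RS noQ [C1 [h1 pf1]] [C2 [h2 pf2]].
have sQ : Q \subset Q :|: (R :|: S) by apply: subsetUl.
have noQ' q r : q \in Q -> r \in (Q :|: (R :|: S)) :\: Q -> ~~ edge q r.
  by move=> qQ; rewrite 2!inE => /andP[/negbTE->]; apply: noQ.
(* A first proof missing [R], or a second one missing [S], already serves for the larger set. *)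
have [/existsP[x0 x0R]|/existsPn noR] := boolP [exists x, h1 x \in R]; last first.
  by exists C1, h1; apply: proof_over_weaken pf1.
have [/existsP[y0 y0S]|/existsPn noS] := boolP [exists x, h2 x \in S]; last first.
  by exists C2, h2; apply: proof_over_weaken pf2.
have [coC1 nC1 hom1 [hQR sk1] ax1] := pf1.
have [coC2 nC2 hom2 [hQS sk2] ax2] := pf2.
have R_edge a b : a \in Q :|: R -> edge a b -> b \in R -> a \in R.
  move=> /setUP[aQ|//] ab bR.
  by have := noQ a b aQ; rewrite ab inE bR => /(_ isT).
have S_edge a b : a \in Q :|: S -> edge a b -> b \in S -> a \in S.
  move=> /setUP[aQ|//] ab bS.
  by have := noQ a b aQ; rewrite ab inE bS orbT => /(_ isT).
have B1e x y : edge x y -> (h1 x \in R) = (h1 y \in R).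
  move=> /hom1 xy; apply/idP/idP; apply: R_edge => //.
  by rewrite edge_sym.
have B2e x y : edge x y -> (h2 x \in S) = (h2 y \in S).
  move=> /hom2 xy; apply/idP/idP; apply: S_edge => //.
  by rewrite edge_sym.
pose h (u : fusion (fun x => h1 x \in R) (fun y => h2 y \in S)) :=
  match u with inl x => h1 x | inr y => h2 y end.
exists (fusion (fun x => h1 x \in R) (fun y => h2 y \in S)), h; split.
- exact: fusion_cograph.
- exact: fusion_nice.
- case=> x [y|y] //= exy; [exact: hom1 | | | exact: hom2].
  + by case/andP: exy; apply: RS.
  + by case/andP: exy; rewrite edge_sym; apply: RS.
- split=> [[x|x]|] /=.
  + by move: (hQR x); rewrite !inE => /orP[]->; rewrite ?orbT.
  + by move: (hQS x); rewrite !inE => /orP[]->; rewrite ?orbT.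
  have lift1 x w : w \in Q :|: R -> edge (h1 x) w ->
      exists u, edge (inl x : fusion _ _) u /\ ~~ edge (h u) w.
    by move=> wA xw; have [x' ?] := sk1 x w wA xw; exists (inl x').
  have lift2 x w : w \in Q :|: S -> edge (h2 x) w ->
      exists u, edge (inr x : fusion _ _) u /\ ~~ edge (h u) w.
    by move=> wA xw; have [x' ?] := sk2 x w wA xw; exists (inr x').
  move=> [x|x] w /= wA xw.
  + have [wQR|] := boolP (w \in Q :|: R); first exact: lift1.
    (* An edge from [R] to [S]: here [x] is adjacent to all vertices over [S]. Take [y0], unless
       [h2 y0] is adjacent to [w]; then lifting in [C2] gives a neighbour [y'] of [y0], hence again
       over [S], that serves instead. *)
    rewrite inE negb_or => /andP[wQ wR].
    have wS : w \in S by move: wA; rewrite !inE (negbTE wQ) (negbTE wR).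
    have xR : h1 x \in R.
      have /setUP[xQ|//] := hQR x; have := noQ _ w xQ.
      by rewrite xw inE wS orbT => /(_ isT).
    have [y0w|y0w] := boolP (edge (h2 y0) w); last first.
      by exists (inr y0); rewrite /edge /= xR y0S.
    have [|y' [y0y' y'w]] := sk2 y0 w _ y0w; first by rewrite inE wS orbT.
    by exists (inr y'); rewrite /edge /= xR -(B2e y0 y').
  have [wQS|] := boolP (w \in Q :|: S); first exact: lift2.
  rewrite inE negb_or => /andP[wQ wS].
  have wR : w \in R by move: wA; rewrite !inE (negbTE wQ) (negbTE wS) orbF.
  have xS : h2 x \in S.
    have /setUP[xQ|//] := hQS x; have := noQ _ w xQ.
    by rewrite xw inE wR => /(_ isT).
  have [x0w|x0w] := boolP (edge (h1 x0) w); last first.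
    by exists (inl x0); rewrite /edge /= xS x0R.
  have [|x' [x0x' x'w]] := sk1 x0 w _ x0w; first by rewrite inE wR orbT.
  by exists (inl x'); rewrite /edge /= xS -(B1e x0 x') ?x0R.
case=> x.
  case: (ax1 x) => [[lx x1]|[y xy dxy]]; last by right; exists (inl y).
  by left; split=> // -[y|y] //= /x1->.
case: (ax2 x) => [[lx x1]|[y xy dxy]]; last by right; exists (inr y).
by left; split=> // -[y|y] //= /x1->.
Qed.

Lemma completeness_over (A : {set P}) : cograph P -> true_over A -> provable A.
Proof.
move=> coP; have [n] := ubnP #|A|; elim: n A => // n IHn A ltAn trA.
have [stA|] := boolP (stable A).
  (* A stable [A] is its own only clause. *)
  apply: provable_stable => //; apply: trA => // x xA.
  by rewrite xA.
rewrite negb_forall_in => /exists_inP[x xA].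
rewrite negb_forall_in => /exists_inP[y yA]; rewrite negbK => exy.
have [R [S [[RA SA] R0 S0 RS noQ]]] := cograph_split coP xA yA exy.
set Q := A :\: (R :|: S) in noQ.
have defA : A = Q :|: (R :|: S).
  by rewrite -{1}(setID A (R :|: S)) setUC (setIidPr _) // subUset RA.
have QA : Q \subset A := subsetDl _ _.
(* Dropping [V] shrinks the set, because completely joined sets are disjoint. *)
have disj (U V : {set P}) : U :|: V = R :|: S -> V != set0 ->
    (forall u v, u \in U -> v \in V -> edge u v) -> #|Q :|: U| < n.
  move=> eqUV /set0Pn[v vV] UV; rewrite -ltnS; apply: leq_trans _ ltAn.
  rewrite ltnS; apply/proper_card/properP; split.
    by rewrite subUset QA (subset_trans (subsetUl U V)) // eqUV subUset RA.
  exists v; first by rewrite defA !inE -in_setU -eqUV inE vV !orbT.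
  rewrite !inE -in_setU -eqUV inE vV orbT /=.
  by apply/negP=> vU; have := UV v v vU vV; rewrite edge_irr.
have SR s r : s \in S -> r \in R -> edge s r.
  by move=> sS rR; rewrite edge_sym RS.
rewrite defA; apply: provable_join => //; apply: IHn.
- exact: (disj R S).
- exact: (true_over_join R0 defA RS noQ trA).
- by apply: (disj S R) => //; apply: setUC.
rewrite setUC in noQ.
by apply: (true_over_join S0 _ SR _ trA); rewrite // defA [S :|: R]setUC.
Qed.

End Completeness.

Theorem theorem2 (X : eqType) (P : labelled_graph X) (hP : cograph P) :
  true_graph P <->
  exists (C : coloured_graph) (h : C -> P), combinatorial_proof h.
Proof.
split=> [trP|[C [h pf]]]; last exact: soundness pf.
have [|C [h pf]] := completeness_over (A := [set: P]) hP.
  move=> W _ stW maxW; apply: trP; apply: clauseI => // v.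
  by apply: maxW; rewrite inE.
by exists C, h; apply: proof_over_setT.
Qed.
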